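(* For every integer $n\ge1$ and every $R\ge1$ there exists a constant $L_{\mathsf G}=L_{\mathsf G}(R,n)$ such that for all $\mu_1,\mu_2\in\mathcal P_R(\mathbb R^n)$, $$d_g(\mathsf G\mu_1,\mathsf G\mu_2)\le L_{\mathsf G}(R,n)\,d_g(\mu_1,\mu_2).$$
   Context: $\mathcal M(\mu)$ and $\mathcal C(\mu)$ are the mean and covariance of $\mu$. $\mathcal P_R(\mathbb R^n)$ is the set of probability measures on $\mathbb R^n$ with $|\mathcal M(\mu)|\le R$ and $R^{-2}I_n\preccurlyeq\mathcal C(\mu)\preccurlyeq R^2I_n$ (Loewner order). $\mathsf G\mu=\mathcal N(\mathcal M(\mu),\mathcal C(\mu))$. With $g(v)=1+|v|^2$ (Euclidean norm), $d_g(\mu_1,\mu_2)=\sup_{|f|\le g}\left|\int f\,d\mu_1-\int f\,d\mu_2\right|$ for probability measures with finite second moments, the supremum being over measurable $f\colon\mathbb R^n\to\mathbb R$ with $|f|\le g$ pointwise. *)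

(* Defs.v *)
From HB Require Import structures.
From mathcomp Require Import all_boot all_order all_algebra.
From mathcomp Require Import all_classical all_reals all_analysis.
From mathcomp Require Import measurable_realfun.

Set Implicit Arguments.
Unset Strict Implicit.
Unset Printing Implicit Defensive.

Import Order.TTheory GRing.Theory Num.Theory.
Import numFieldNormedType.Exports.

Local Open Scope classical_set_scope.
Local Open Scope ring_scope.

(* R^n is carried by n-tuples, whose library sigma-algebra is the one generated
   by the coordinates, i.e. the Borel sigma-algebra of R^n. *)
Notation Rn R n := (n.-tuple (measurableTypeR R)).

Section euclidean_space.
Context {R : realType} {n : nat}.

Definition coord (i : 'I_n) (x : Rn R n) : R := tnth x i.

Definition vec (x : Rn R n) : 'cV[R]_n := \col_i coord i x.

Definition enorm (v : 'cV[R]_n) : R := Num.sqrt (\sum_i v i ord0 ^+ 2).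

Definition psd (A : 'M[R]_n) : Prop :=
  A^T = A /\ forall v : 'cV[R]_n, 0 <= (v^T *m A *m v) ord0 ord0.

Definition loewner_le (A B : 'M[R]_n) : Prop := psd (B - A).

Lemma measurable_coord (i : 'I_n) : measurable_fun [set: Rn R n] (coord i).
Proof. exact: measurable_tnth. Qed.

End euclidean_space.

Section cons_measure.
Context {R : realType} {n : nat}.
Local Open Scope ereal_scope.

Definition cons_Rn (p : measurableTypeR R * Rn R n) : Rn R n.+1 :=
  [tuple of p.1 :: p.2].

Lemma measurable_cons_Rn : measurable_fun setT cons_Rn.
Proof. exact: measurable_cons. Qed.

Let uncons_Rn (x : Rn R n.+1) : measurableTypeR R * Rn R n :=
  (thead x, [tuple of behead x]).

Let cons_RnK : cancel cons_Rn uncons_Rn.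
Proof. by move=> [x y]; congr pair; exact/val_inj. Qed.

Let measurable_uncons_Rn : measurable_fun setT uncons_Rn.
Proof.
by apply: measurable_fun_pair; [exact: measurable_tnth|exact: measurable_behead].
Qed.

Variable m : {sigma_finite_measure set (Rn R n) -> \bar R}.

Definition cons_measure : set (Rn R n.+1) -> \bar R :=
  pushforward (@lebesgue_measure R \x m) cons_Rn.

Let preimage_cons_Rn A : measurable A -> measurable (cons_Rn @^-1` A).
Proof.
by move=> mA; rewrite -[X in measurable X]setTI; exact: measurable_cons_Rn.
Qed.

Let cons_measure0 : cons_measure set0 = 0.
Proof. by rewrite /cons_measure /pushforward preimage_set0 measure0. Qed.

Let cons_measure_ge0 A : 0 <= cons_measure A.
Proof. exact: (measure_ge0 (@lebesgue_measure R \x m)). Qed.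

Let cons_measure_sigma_additive : semi_sigma_additive cons_measure.
Proof.
move=> F mF tF mUF; rewrite /cons_measure /pushforward preimage_bigcup.
apply: measure_semi_sigma_additive.
- by move=> i; exact: preimage_cons_Rn.
- apply/trivIsetP => /= i j _ _ ij; rewrite -preimage_setI.
  by move/trivIsetP : tF => /(_ _ _ _ _ ij) ->//; rewrite preimage_set0.
- by rewrite -preimage_bigcup; exact: preimage_cons_Rn.
Qed.

HB.instance Definition _ := isMeasure.Build _ _ _ cons_measure
  cons_measure0 cons_measure_ge0 cons_measure_sigma_additive.

Let cons_measure_sigma_finite : sigma_finite setT cons_measure.
Proof.
have /sigma_finiteP[F [FT ndF Foo]] := sigma_finiteT (@lebesgue_measure R).
have /sigma_finiteP[G [GT ndG Goo]] := sigma_finiteT m.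
exists (fun i => uncons_Rn @^-1` (F i `*` G i)).
  rewrite -preimage_bigcup (_ : \bigcup_i (F i `*` G i) = setT) ?preimage_setT//.
  rewrite -setXTT FT GT predeqE => -[x y]; split.
    by move=> [/= i _ []/= ? ?]; split; exists i.
  move=> [/= [i _ Fix] [k _ Gky]]; exists (maxn i k) => //; split.
  - by move: x Fix; exact/subsetPset/ndF/leq_maxl.
  - by move: y Gky; exact/subsetPset/ndG/leq_maxr.
move=> i; have [mF Fi] := Foo i; have [mG Gi] := Goo i; split; last first.
  rewrite /cons_measure /pushforward -comp_preimage.
  rewrite (_ : uncons_Rn \o cons_Rn = id) ?preimage_id; last exact/funext.
  rewrite product_measure1E//.
  by rewrite lte_mul_pinfty// ge0_fin_numE.
rewrite -[X in measurable X]setTI; apply: measurable_uncons_Rn => //.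
exact: measurableX.
Qed.

HB.instance Definition _ := Measure_isSigmaFinite.Build _ _ _ cons_measure
  cons_measure_sigma_finite.

End cons_measure.

Fixpoint lebesgue_Rn (R : realType) (n : nat) :
    {sigma_finite_measure set (Rn R n) -> \bar R} :=
  match n with
  | 0 => \d_([tuple] : Rn R 0)
  | n'.+1 => cons_measure (lebesgue_Rn R n')
  end.

Section gaussian_measure.
Context {R : realType} {n : nat}.

Definition gaussian_pdf (m : 'cV[R]_n) (C : 'M[R]_n) (x : Rn R n) : R :=
  (Num.sqrt (\det ((2 * pi) *: C)))^-1 *
  expR (- (((vec x - m)^T *m invmx C *m (vec x - m)) ord0 ord0 / 2)).

Lemma gaussian_pdf_ge0 m C x : 0 <= gaussian_pdf m C x.
Proof. by rewrite mulr_ge0 ?invr_ge0 ?sqrtr_ge0 ?expR_ge0. Qed.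

Lemma measurable_gaussian_pdf m C : measurable_fun [set: Rn R n] (gaussian_pdf m C).
Proof.
apply: measurable_funM => //; apply: measurableT_comp => //.
apply: measurableT_comp => //; apply: measurable_funM => //.
have mvec (i : 'I_n) : measurable_fun [set: Rn R n]
    (fun x => (vec x - m) i ord0 : R).
  rewrite (_ : (fun _ => _) = coord i \- cst (m i ord0)).
    by apply: measurable_funB => //; exact: measurable_coord.
  by apply/funext => x; rewrite !mxE.
under eq_fun do rewrite mxE.
apply: measurable_sum => j; apply: measurable_funM; last exact: mvec.
under eq_fun do rewrite mxE.
apply: measurable_sum => k; apply: measurable_funM => //.
by under eq_fun do rewrite mxE; exact: mvec.
Qed.

(* N(m, C) for positive definite C; when \det C = 0 the normalizing factor is
   0^-1 = 0 and this is the zero measure. *)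
Definition gaussian (m : 'cV[R]_n) (C : 'M[R]_n) : set (Rn R n) -> \bar R :=
  fun A => (\int[lebesgue_Rn R n]_(x in A) (gaussian_pdf m C x)%:E)%E.

Variables (m : 'cV[R]_n) (C : 'M[R]_n).
Local Open Scope ereal_scope.

Let gaussian0 : gaussian m C set0 = 0.
Proof. exact: integral_set0. Qed.

Let gaussian_ge0 A : 0 <= gaussian m C A.
Proof. by apply: integral_ge0 => x _; rewrite lee_fin gaussian_pdf_ge0. Qed.

Let gaussian_sigma_additive : semi_sigma_additive (gaussian m C).
Proof.
apply: semi_sigma_additive_nng_induced => [|x].
  by apply/measurable_EFinP; exact: measurable_gaussian_pdf.
by rewrite lee_fin gaussian_pdf_ge0.
Qed.

HB.instance Definition _ := isMeasure.Build _ _ _ (gaussian m C)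
  gaussian0 gaussian_ge0 gaussian_sigma_additive.

End gaussian_measure.

Section moments.
Context {R : realType} {n : nat}.

Definition mean (mu : probability (Rn R n) R) : 'cV[R]_n :=
  \col_i fine 'E_mu[coord i].

Definition cov (mu : probability (Rn R n) R) : 'M[R]_n :=
  \matrix_(i, j) fine (covariance mu (coord i) (coord j)).

(* Finiteness of the second moment, implicit in speaking of the mean and
   covariance, has to be required: expectations are total in the library. *)
Definition in_PR (r : R) (mu : probability (Rn R n) R) : Prop :=
  [/\ (\int[mu]_x (enorm (vec x) ^+ 2)%:E < +oo)%E,
      enorm (mean mu) <= r,
      loewner_le ((r ^- 2)%:M) (cov mu) &
      loewner_le (cov mu) ((r ^+ 2)%:M)].

Definition gaussian_proj (mu : probability (Rn R n) R) :
    {measure set (Rn R n) -> \bar R} :=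
  gaussian (mean mu) (cov mu).

End moments.

Section weighted_distance.
Context {R : realType} {n : nat}.

Definition weight (x : Rn R n) : R := 1 + enorm (vec x) ^+ 2.

(* The supremum makes sense for all measures; it is meant for probability
   measures with finite second moments, for which every integral is finite. *)
Definition dg (mu1 mu2 : {measure set (Rn R n) -> \bar R}) : \bar R :=
  ereal_sup [set `|\int[mu1]_x (f x)%:E - \int[mu2]_x (f x)%:E|%E |
    f in [set f : Rn R n -> R |
      measurable_fun setT f /\ forall x, `|f x| <= weight x]].

End weighted_distance.

(* Main.v *)
Require Import Defs.
From mathcomp Require Import all_boot all_order all_algebra.
From mathcomp Require Import all_classical all_reals all_analysis.
From mathcomp Require Import measurable_realfun perm ring lra.

Set Implicit Arguments.
Unset Strict Implicit.
Unset Printing Implicit Defensive.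

Import Order.TTheory GRing.Theory Num.Theory.
Import numFieldNormedType.Exports.
(* In the sequel [coord] is a coordinate of a point of R^n, not the coordinate of
   a vector on a basis. *)
Import Defs.

Local Open Scope classical_set_scope.
Local Open Scope ring_scope.

(** The gaussian projection factors through the mean and the covariance, and both
    steps are Lipschitz.

    The coordinates [x_i] and their products [x_i x_j] are dominated by the weight
    [g], so that the first and second moments of the two measures differ by at
    most [d = d_g(mu1, mu2)]. The means being bounded by [r], the entries of the
    covariances then differ by at most [(1 + 2r) d] ([mean_dg], [cov_dg]).

    The density of a gaussian is a Lipschitz function of its mean and covariance
    as long as these satisfy the bounds defining P_r ([gaussian_pdf_lip]). The
    bounds on the covariance [C] bound the entries of [C] and of its inverse, hence
    keep the determinant of [C] away from [0]; the resolvent identity makes the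
    inverse Lipschitz, and a telescoping sum makes the determinant Lipschitz. The
    upper bound on [C] also bounds the exponent of the density below by
    [|x|^2 / (4 r^2) - 1/2]. Differences of densities are thus at most
    [(1 + |x|^2)^2 exp(- |x|^2 / (4 r^2))] times a constant times the difference of
    the parameters. Half of the exponential decay absorbs the polynomial and the
    weight [g], which leaves the fixed function [exp(- |x|^2 / (8 r^2))].

    This envelope is a product of one-dimensional gaussian functions, and so has a
    finite integral over R^n ([integral_lebesgue_Rn_expR]). Writing the integrals
    against the two gaussian measures as integrals of densities and integrating the
    pointwise bound concludes ([integral_density_dist]). *)

(** * Measures with a density *)

Section density.
Context d (T : measurableType d) (R : realType).
Variables (mu nu : {measure set T -> \bar R}) (p : T -> R).
Hypothesis mp : measurable_fun setT p.
Hypothesis p0 : forall x, 0 <= p x.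
Hypothesis nuE : forall A, measurable A -> nu A = (\int[mu]_(x in A) (p x)%:E)%E.
Local Open Scope ereal_scope.

Let integral_indic_density A (mA : measurable A) :
  \int[nu]_x (\1_A x)%:E = \int[mu]_x ((\1_A x)%:E * (p x)%:E).
Proof.
rewrite integral_indic// setIT nuE// integral_mkcond.
apply: eq_integral => x _; rewrite patchE indicE.
by case: ifP => _; rewrite ?mul1e ?mul0e.
Qed.

Import HBNNSimple.

Let integral_nnsfun_density (h : {nnsfun T >-> R}) :
  \int[nu]_x (h x)%:E = \int[mu]_x ((h x)%:E * (p x)%:E).
Proof.
have hE x : (h x)%:E =
    \sum_(y \in range h) (y%:E * (\1_(h @^-1` [set y]) x)%:E).
  by rewrite fimfunE -fsumEFin.
have mI y : measurable_fun setT (fun x => (\1_(h @^-1` [set y]) x)%:E : \bar R).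
  exact/measurable_EFinP.
have h0 y x : 0 <= y%:E * (\1_(h @^-1` [set y]) x)%:E.
  exact: nnfun_muleindic_ge0.
have hp x : (h x)%:E * (p x)%:E = \sum_(y \in range h)
    (y%:E * ((\1_(h @^-1` [set y]) x)%:E * (p x)%:E)).
  rewrite hE ge0_mule_fsuml => [|y]; last exact: h0.
  by apply: eq_fsbigr => y _; rewrite muleA.
under eq_integral do rewrite hE.
under [RHS]eq_integral do rewrite hp.
rewrite !ge0_integral_fsum//; first last.
- by move=> y; apply: measurable_funeM.
- by move=> y x _; rewrite muleA mule_ge0// lee_fin.
- move=> y; apply: measurable_funeM; apply: emeasurable_funM => //.
  exact/measurable_EFinP.
apply: eq_fsbigr => y /[!inE] -[x _ <-].
have hx0 : 0 <= (h x)%:E by rewrite lee_fin fun_ge0.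
rewrite ge0_integralZl//.
rewrite ge0_integralZl//; last by move=> z _; rewrite mule_ge0 ?lee_fin.
  by rewrite integral_indic_density.
by apply: emeasurable_funM => //; exact/measurable_EFinP.
Qed.

Lemma ge0_integral_density (f : T -> \bar R) : measurable_fun setT f ->
  (forall x, 0 <= f x) -> \int[nu]_x f x = \int[mu]_x (f x * (p x)%:E).
Proof.
move=> mf f0; pose h := nnsfun_approx measurableT mf.
have hf x : (h n x)%:E @[n --> \oo] --> f x by exact: cvg_nnsfun_approx.
have ndh x a b : (a <= b)%N -> (h a x)%:E <= (h b x)%:E.
  by move=> ab; rewrite lee_fin; exact/lefP/nd_nnsfun_approx.
have mh n : measurable_fun setT (fun x => (h n x)%:E) by exact/measurable_EFinP.
have -> : \int[nu]_x f x = limn (fun n => \int[nu]_x (h n x)%:E).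
  rewrite -monotone_convergence//; last 2 first.
    by move=> n x _; rewrite lee_fin.
    by move=> x _ a b; exact: ndh.
  by apply: eq_integral => x _; exact/esym/cvg_lim.
have -> : \int[mu]_x (f x * (p x)%:E) =
    limn (fun n => \int[mu]_x ((h n x)%:E * (p x)%:E)).
  rewrite -monotone_convergence//; last 3 first.
    by move=> n; apply: emeasurable_funM => //; exact/measurable_EFinP.
    by move=> n x _; rewrite mule_ge0 ?lee_fin.
    by move=> x _ a b ab; rewrite lee_wpmul2r ?lee_fin// -lee_fin ndh.
  by apply: eq_integral => x _; apply/esym/cvg_lim => //; exact: cvgeZr.
by under eq_fun do rewrite integral_nnsfun_density.
Qed.

(** A real-valued [f] need not be integrable: its positive and negative parts are
    treated separately, with the same conventions for undefined differences on
    both sides. *)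
Lemma integral_density (f : T -> R) : measurable_fun setT f ->
  \int[nu]_x (f x)%:E = \int[mu]_x (f x * p x)%:E.
Proof.
move=> mf; have mF : measurable_fun setT (EFin \o f) by exact/measurable_EFinP.
rewrite integralE [RHS]integralE; congr (_ - _).
- rewrite ge0_integral_density//; last exact: measurable_funepos.
  apply: eq_integral => x _; rewrite !funeposE -!EFin_max -EFinM.
  by rewrite maxr_pMl// mul0r.
- rewrite ge0_integral_density//; last exact: measurable_funeneg.
  apply: eq_integral => x _; rewrite !funenegE -!EFinN -!EFin_max -EFinM.
  by rewrite maxr_pMl// mul0r mulNr.
Qed.

End density.

Section density_distance.
Context d (T : measurableType d) (R : realType).
Variables (mu nu1 nu2 : {measure set T -> \bar R}) (p1 p2 f H : T -> R).
Local Open Scope ereal_scope.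

(** The bounds with [K1] ensure that both integrals are finite; they are then
    merged, which makes the difference of the densities appear. *)
Lemma integral_density_dist (J K1 K2 : R) :
  measurable_fun setT p1 -> measurable_fun setT p2 ->
  (forall x, 0 <= p1 x)%R -> (forall x, 0 <= p2 x)%R ->
  (forall A, measurable A -> nu1 A = \int[mu]_(x in A) (p1 x)%:E) ->
  (forall A, measurable A -> nu2 A = \int[mu]_(x in A) (p2 x)%:E) ->
  measurable_fun setT f -> measurable_fun setT H ->
  (forall x, 0 <= H x)%R -> \int[mu]_x (H x)%:E = J%:E ->
  (forall x, `|f x| * p1 x <= K1 * H x)%R ->
  (forall x, `|f x| * p2 x <= K1 * H x)%R -> (0 <= K2)%R ->
  (forall x, `|f x| * `|p1 x - p2 x| <= K2 * H x)%R ->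
  `|\int[nu1]_x (f x)%:E - \int[nu2]_x (f x)%:E| <= (K2 * J)%:E.
Proof.
move=> mp1 mp2 p10 p20 nu1E nu2E mf mH H0 HJ fp1 fp2 K20 fp.
have iH : mu.-integrable setT (EFin \o H).
  apply/integrableP; split; first exact/measurable_EFinP.
  under eq_integral do rewrite /= ger0_norm//.
  by rewrite HJ ltry.
have iK1 : mu.-integrable setT (EFin \o (fun x => K1 * H x)%R).
  exact: (integrableZl measurableT K1 iH).
have ip (p : T -> R) : measurable_fun setT p -> (forall x, 0 <= p x)%R ->
    (forall x, `|f x| * p x <= K1 * H x)%R ->
    mu.-integrable setT (EFin \o (fun x => f x * p x)%R).
  move=> mp p0 fpK; apply: (le_integrable measurableT _ _ iK1).
    by apply/measurable_EFinP; exact: measurable_funM.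
  move=> x _; rewrite /= lee_fin normrM (ger0_norm (p0 x)).
  by rewrite (le_trans (fpK x))// ler_norm.
rewrite (integral_density mp1 p10 nu1E)// (integral_density mp2 p20 nu2E)//.
rewrite -integralB_EFin//; [|exact: ip..].
have mfp : measurable_fun setT (fun x => (f x * p1 x)%:E - (f x * p2 x)%:E).
  apply/measurable_EFinP/measurable_funB; exact: measurable_funM.
apply: (le_trans (le_abse_integral _ _ _)) => //.
have HE : \int[mu]_x (K2%:E * (H x)%:E) = (K2 * J)%:E.
  rewrite ge0_integralZl_EFin//; first by rewrite HJ.
    by move=> x _; rewrite lee_fin.
  exact/measurable_EFinP.
rewrite -HE.
apply: ge0_le_integral => //.
- exact: measurableT_comp.
- by apply: measurable_funeM; exact/measurable_EFinP.
- by move=> x _; rewrite -EFinB -mulrBr -EFinM lee_fin normrM.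
Qed.

End density_distance.

(** * Gaussian integrals over R^n *)

Section product_integral.
Context {R : realType}.
Local Open Scope ereal_scope.

Lemma integral_lebesgue_Rn_prod (f : R -> R) (a : R) n :
  measurable_fun setT f -> (forall t, 0 <= f t)%R ->
  \int[lebesgue_measure]_t (f t)%:E = a%:E ->
  \int[lebesgue_Rn R n]_x (\prod_(i < n) f (coord i x))%R%:E = (a ^+ n)%:E.
Proof.
move=> mf f0 fa; elim: n => [|n IHn].
  rewrite integral_dirac//; last first.
    rewrite (_ : (fun _ => _) = cst 1) //.
    by apply/funext => x; rewrite big_ord0.
  by rewrite diracT mul1e big_ord0 expr0.
have mprod k : measurable_fun [set: Rn R k] (fun x => \prod_(i < k) f (coord i x))%R.
  apply: measurable_prod => i _.
  exact: (measurableT_comp mf (measurable_coord i)).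
have mprodE k : measurable_fun [set: Rn R k]
    (fun x => (\prod_(i < k) f (coord i x))%R%:E).
  by apply/measurable_EFinP; apply: mprod.
have prod0 k (x : Rn R k) : (0 <= \prod_(i < k) f (coord i x))%R.
  by rewrite prodr_ge0.
rewrite /= ge0_integral_pushforward//=; last 3 first.
- exact: measurable_cons_Rn.
- exact: mprodE.
- by move=> y _; rewrite lee_fin; exact: prod0.
have consE (p : measurableTypeR R * Rn R n) :
    (\prod_(i < n.+1) f (coord i (cons_Rn p)))%R =
    (f p.1 * \prod_(i < n) f (coord i p.2))%R.
  rewrite big_ord_recl; congr (_ * _)%R.
  by apply: eq_bigr => i _; rewrite /coord tnthS.
rewrite preimage_setT.
under eq_integral do rewrite /= consE.
rewrite fubini_tonelli1//=; last 2 first.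
- apply/measurable_EFinP/measurable_funM.
    exact: measurableT_comp.
  by apply: (measurableT_comp (mprod n)).
- by move=> x; rewrite lee_fin mulr_ge0//; exact: prod0.
rewrite /fubini_F /=.
have inner t : \int[lebesgue_Rn R n]_y (f t * \prod_(i < n) f (coord i y))%:E =
    (f t)%:E * (a ^+ n)%:E.
  rewrite -IHn -ge0_integralZl//.
  - exact: mprodE.
  - by move=> y _; rewrite lee_fin; exact: prod0.
  - by rewrite lee_fin.
under eq_integral do rewrite inner.
rewrite ge0_integralZr//; last 3 first.
- exact/measurable_EFinP.
- by move=> t _; rewrite lee_fin.
- by rewrite -IHn integral_ge0// => x _; rewrite lee_fin; exact: prod0.
by rewrite fa -EFinM exprS.
Qed.

(** The exponential of the sum is the product of the densities of centered normal
    laws of variance [s ^+ 2], up to the normalizing constant of these laws. *)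
Lemma integral_lebesgue_Rn_expR (s : R) n : (s != 0)%R ->
  \int[lebesgue_Rn R n]_x
    (expR (- (\sum_(i < n) coord i x ^+ 2 / (s ^+ 2 *+ 2))))%R%:E
  = ((normal_peak s)^-1 ^+ n)%:E.
Proof.
move=> s0; rewrite -(@integral_lebesgue_Rn_prod (normal_fun 0 s)).
- apply: eq_integral => x _; congr (_%:E).
  rewrite -sumrN expR_sum; apply: eq_bigr => i _.
  by rewrite /normal_fun subr0 mulNr.
- exact: measurable_normal_fun.
- exact: normal_fun_ge0.
have p0 := normal_peak_gt0 s0.
have := @integral_normal_pdf R 0 s; rewrite normal_pdfE//.
under eq_integral do rewrite EFinM.
rewrite ge0_integralZl//; last 3 first.
- by apply/measurable_EFinP; exact: measurable_normal_fun.
- by move=> x _; rewrite lee_fin normal_fun_ge0.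
- by rewrite lee_fin ltW.
move=> E; rewrite -[LHS]mul1e -(mulVf (lt0r_neq0 p0)) EFinM -muleA E.
by rewrite mule1.
Qed.

End product_integral.

(** * Matrices between two multiples of the identity *)

Section sandwich.
Context {R : realType} {n : nat}.
Implicit Types (A B C : 'M[R]_n) (u v w : 'cV[R]_n).

Definition dotp u v : R := (u^T *m v) ord0 ord0.

Lemma dotpE u v : dotp u v = \sum_i u i ord0 * v i ord0.
Proof. by rewrite /dotp mxE; apply: eq_bigr => i _; rewrite mxE. Qed.

Lemma dotpC u v : dotp u v = dotp v u.
Proof. by rewrite !dotpE; apply: eq_bigr => i _; rewrite mulrC. Qed.

Lemma dotpDl u v w : dotp (u + v) w = dotp u w + dotp v w.
Proof. by rewrite /dotp linearD mulmxDl mxE. Qed.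

Lemma dotpZl a u v : dotp (a *: u) v = a * dotp u v.
Proof. by rewrite /dotp linearZ -scalemxAl mxE. Qed.

Lemma dotpDr u v w : dotp u (v + w) = dotp u v + dotp u w.
Proof. by rewrite dotpC dotpDl !(dotpC _ u). Qed.

Lemma dotpZr a u v : dotp u (a *: v) = a * dotp u v.
Proof. by rewrite dotpC dotpZl dotpC. Qed.

Lemma dotp_ge0 u : 0 <= dotp u u.
Proof. by rewrite dotpE sumr_ge0// => i _; rewrite -expr2 sqr_ge0. Qed.

Lemma dotp_eq0 u : dotp u u = 0 -> u = 0.
Proof.
rewrite dotpE => /eqP; rewrite psumr_eq0 => [/allP u0|i _]; last first.
  by rewrite -expr2 sqr_ge0.
apply/colP => i; rewrite mxE; apply/eqP.
by have := u0 i (mem_index_enum _); rewrite mulf_eq0 orbb.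
Qed.

Lemma dotp_delta i v : dotp (delta_mx i ord0) v = v i ord0.
Proof.
rewrite dotpE (bigD1 i)//= mxE !eqxx mul1r big1 ?addr0// => j ji.
by rewrite mxE (negPf ji) mul0r.
Qed.

Lemma sqr_entry_le_dotp v i : v i ord0 ^+ 2 <= dotp v v.
Proof.
rewrite dotpE (bigD1 i)//= -expr2 lerDl sumr_ge0// => j _.
by rewrite -expr2 sqr_ge0.
Qed.

Lemma dotp_mx C u v : dotp u (C *m v) = dotp (C^T *m u) v.
Proof. by rewrite /dotp trmx_mul trmxK mulmxA. Qed.

Section bounds.
Variables (r : R) (C : 'M[R]_n).
Hypothesis r1 : 1 <= r.
Hypothesis lC : loewner_le (r ^- 2)%:M C.
Hypothesis uC : loewner_le C (r ^+ 2)%:M.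

Let r0 : 0 < r. Proof. exact: lt_le_trans r1. Qed.
Let r2 : 0 < r ^+ 2. Proof. exact: exprn_gt0. Qed.

Let formB A B v :
  (v^T *m (A - B) *m v) ord0 ord0 = dotp v (A *m v) - dotp v (B *m v).
Proof. by rewrite -mulmxA mulmxBl mulmxBr /dotp !mxE. Qed.

Lemma loewner_sym : C^T = C.
Proof.
case: lC => + _; rewrite linearB/= tr_scalar_mx.
by move=> /(congr1 (fun M => M + (r ^- 2)%:M)); rewrite !subrK.
Qed.

Lemma loewner_form_ge v : r ^- 2 * dotp v v <= dotp v (C *m v).
Proof.
by case: lC => _ /(_ v); rewrite formB mul_scalar_mx dotpZr subr_ge0.
Qed.

Lemma loewner_form_le v : dotp v (C *m v) <= r ^+ 2 * dotp v v.
Proof.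
by case: uC => _ /(_ v); rewrite formB mul_scalar_mx dotpZr subr_ge0.
Qed.

Lemma loewner_unitmx : C \in unitmx.
Proof.
rewrite -row_free_unit -kermx_eq0; apply/negbNE/negP => /rowV0Pn[w].
rewrite (sameP sub_kermxP eqP) => /eqP wC /eqP w0; apply: w0.
suff : w^T = 0 by move=> /(congr1 trmx); rewrite trmxK trmx0.
apply/dotp_eq0/eqP; rewrite eq_le dotp_ge0 andbT.
have := loewner_form_ge w^T.
rewrite -{1}loewner_sym -trmx_mul wC /dotp trmx0 mulmx0 [leRHS]mxE.
by rewrite pmulr_rle0// invr_gt0.
Qed.

(** Entries of a positive semidefinite matrix are recovered from the values of
    its form on [e_i + e_j] and [e_i - e_j]. *)
Lemma loewner_entry i j : `|C i j| <= r ^+ 2.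
Proof.
have E k l : dotp (delta_mx k ord0) (C *m delta_mx l ord0) = C k l.
  by rewrite dotp_delta -colE mxE.
have D (k l : 'I_n) :
    dotp (delta_mx k ord0) (delta_mx l ord0) = (k == l)%:R.
  by rewrite dotp_delta mxE eqxx andbT.
have Cji : C j i = C i j by rewrite -{1}loewner_sym mxE.
have /andP[Ci Cj] : (0 <= C i i) && (0 <= C j j).
  by rewrite -!E; apply/andP; split; apply: le_trans (loewner_form_ge _);
    rewrite mulr_ge0 ?dotp_ge0// invr_ge0 ltW.
have P s := loewner_form_le (delta_mx i ord0 + s *: delta_mx j ord0).
have [<-|ij] := eqVneq i j.
  rewrite ger0_norm//; have := loewner_form_le (delta_mx i ord0).
  by rewrite E D eqxx mulr1.
have Q s : C i i + s * C i j + s * C i j + s * (s * C j j) <=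
    r ^+ 2 * (1 + s * s).
  have := P s; rewrite mulmxDr -scalemxAr !(dotpDl, dotpDr, dotpZl, dotpZr).
  rewrite !E !D !eqxx (negPf ij) eq_sym (negPf ij) Cji !mulr0 mulr1 addr0 add0r.
  by rewrite (mulrDr s) addrA /=.
have := Q 1; have := Q (-1); rewrite ler_norml; nra.
Qed.

(** With [w = C^-1 v], the lower bound on [C] gives [r^-2 |w|^2 <= <w, v>], and
    [<w, v>] is bounded by expanding [0 <= |r v - r^-1 w|^2]. *)
Lemma loewner_inv_dotp v : dotp (invmx C *m v) (invmx C *m v) <= r ^+ 4 * dotp v v.
Proof.
set w := invmx C *m v; have Cw : C *m w = v by rewrite /w mulKVmx// loewner_unitmx.
have h1 := loewner_form_ge w; rewrite Cw in h1.
have h2 := dotp_ge0 (r *: v + (- r^-1) *: w).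
rewrite !(dotpDl, dotpDr, dotpZl, dotpZr) (dotpC v w) in h2.
rewrite -[r ^+ 4]/(r ^+ (2 * 2)) exprM [r ^+ 2 ^+ 2]expr2 -mulrA.
rewrite -ler_pdivrMl//.
have e1 : r * (- r^-1 * dotp w v) = - dotp w v.
  by rewrite mulNr mulrN mulrA divff ?mul1r// gt_eqF.
have e3 : - r^-1 * (- r^-1 * dotp w w) = r ^- 2 * dotp w w.
  by rewrite mulrA mulrNN -expr2 exprVn.
rewrite e1 e3 in h2; lra.
Qed.

Lemma loewner_inv_entry i j : `|invmx C i j| <= r ^+ 2.
Proof.
have := sqr_entry_le_dotp (invmx C *m delta_mx j ord0) i.
move=> /le_trans/(_ (loewner_inv_dotp _)); rewrite -colE mxE.
rewrite dotp_delta mxE !eqxx mulr1 -[r ^+ 4]/(r ^+ (2 * 2)) exprM.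
by rewrite -(real_normK (num_real (invmx C i j))) ler_sqr ?nnegrE// ltW.
Qed.

(** The form of [C] is nonnegative at [C^-1 v - t v], where it equals
    [<v, C^-1 v> - 2 t |v|^2 + t^2 <v, C v>]; the upper bound on [C] makes
    [t = r^-2] the best choice. *)
Lemma loewner_inv_form v : r ^- 2 * dotp v v <= dotp v (invmx C *m v).
Proof.
set w := invmx C *m v; have Cw : C *m w = v by rewrite /w mulKVmx// loewner_unitmx.
set t := r ^- 2.
have t0 : 0 < t by rewrite invr_gt0.
have tr : t * r ^+ 2 = 1 by rewrite mulVf// gt_eqF.
have /(ler_wpM2l (ltW t0)) := loewner_form_le v.
rewrite mulrA tr mul1r => /(ler_wpM2l (ltW t0)) h.
have := le_trans (mulr_ge0 (ltW t0) (dotp_ge0 _))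
  (loewner_form_ge (w + (- t) *: v)).
rewrite mulmxDr Cw -scalemxAr !(dotpDl, dotpDr, dotpZl, dotpZr).
rewrite dotp_mx loewner_sym Cw (dotpC w v).
lra.
Qed.

End bounds.
End sandwich.

(** * Lipschitz bounds for scalar functions *)

Section scalar_bounds.
Context {R : realType}.

Lemma expRN_lip (a b c : R) : c <= a -> c <= b ->
  `|expR (- a) - expR (- b)| <= `|a - b| * expR (- c).
Proof.
wlog ab : a b / a <= b.
  move=> H ca cb; have [ab|/ltW ba] := leP a b; first exact: H.
  by rewrite distrC (distrC a); exact: H.
move=> ca cb; rewrite ger0_norm ?subr_ge0 ?ler_expR ?lerN2//.
rewrite distrC ger0_norm ?subr_ge0//.
have -> : expR (- b) = expR (- a) * expR (- (b - a)).
  by rewrite -expRD; congr expR; ring.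
rewrite -[X in X - _]mulr1 -mulrBr mulrC ler_pM ?expR_ge0 ?ler_expR ?lerN2//.
  by rewrite subr_ge0 -[leRHS]expR0 ler_expR oppr_le0 subr_ge0.
have := expR_ge1Dx (- (b - a)); lra.
Qed.

(** The sign of the arguments does not matter: the square root of a negative
    number is [0], and so is the inverse of [0], so that the function is
    constant on the negative half-line, while two arguments of opposite signs
    are at distance at least [c]. *)
Lemma invsqrt_lip (c x y : R) : 0 < c -> c <= `|x| -> c <= `|y| ->
  `|(Num.sqrt x)^-1 - (Num.sqrt y)^-1| <= (c * Num.sqrt c)^-1 * `|x - y|.
Proof.
move=> c0; wlog xy : x y / x <= y.
  move=> H cx cy; have [xy|/ltW yx] := leP x y; first exact: H.
  by rewrite distrC (distrC x); exact: H.
move=> cx cy; have sc0 : 0 < Num.sqrt c by rewrite sqrtr_gt0.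
have rhs0 (z : R) : 0 <= (c * Num.sqrt c)^-1 * `|z|.
  by rewrite mulr_ge0// invr_ge0 mulr_ge0// ltW.
have [y0|y0] := leP y 0.
  rewrite (ler0_sqrtr y0) (ler0_sqrtr (le_trans xy y0)).
  by rewrite subrr normr0 rhs0.
rewrite (ger0_norm (ltW y0)) in cy.
have sy : Num.sqrt c <= Num.sqrt y by rewrite ler_wsqrtr.
have sy0 : 0 < Num.sqrt y by exact: lt_le_trans sy.
have [x0|x0] := leP x 0.
  rewrite (ler0_sqrtr x0) invr0 sub0r normrN ger0_norm ?invr_ge0 ?sqrtr_ge0//.
  rewrite (ler0_norm x0) in cx.
  apply: (@le_trans _ _ (Num.sqrt c)^-1); first by rewrite lef_pV2 ?posrE.
  rewrite invfM mulrAC ler_peMl ?invr_ge0 ?sqrtr_ge0//.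
  by rewrite ler_pdivlMl// mulr1 distrC ger0_norm; lra.
rewrite (ger0_norm (ltW x0)) in cx.
have sx : Num.sqrt c <= Num.sqrt x by rewrite ler_wsqrtr.
have sx0 : 0 < Num.sqrt x by exact: lt_le_trans sx.
have -> : x - y = (Num.sqrt x - Num.sqrt y) * (Num.sqrt x + Num.sqrt y).
  by rewrite -subr_sqr !sqr_sqrtr// ltW.
rewrite -{1}(sqr_sqrtr (ltW c0)).
move: (Num.sqrt x) (Num.sqrt y) (Num.sqrt c) sx sx0 sy sy0 sc0.
move=> a b k ka a0 kb b0 k0.
have -> : a^-1 - b^-1 = (a * b)^-1 * (b - a) by field; rewrite !gt_eqF.
rewrite !normrM (distrC b) [leRHS]mulrCA [leRHS]mulrC ler_wpM2r//.
rewrite !ger0_norm ?invr_ge0 ?mulr_ge0 ?addr_ge0 1?(ltW a0) 1?(ltW b0)//.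
rewrite ler_pdivlMl ?mulr_gt0 ?exprn_gt0// ler_pdivrMr ?mulr_gt0//.
have k0' := ltW k0.
have kk : k * k <= a * b by exact: ler_pM.
have kab : k <= a + b by lra.
by rewrite expr2 mulrC; apply: ler_pM => //; exact: mulr_ge0.
Qed.

Lemma invsqrt_le (c x : R) : 0 < c -> c <= `|x| ->
  (Num.sqrt x)^-1 <= (Num.sqrt c)^-1.
Proof.
move=> c0 cx; have [x0|x0] := leP x 0; first by rewrite ler0_sqrtr// invr0 invr_ge0.
rewrite (ger0_norm (ltW x0)) in cx.
by rewrite lef_pV2 ?posrE ?sqrtr_gt0// ler_wsqrtr.
Qed.

(** Half of the exponential decay absorbs a cubic polynomial in [s]. *)
Lemma poly3_expR_le (a s : R) : 1 <= 3 * a -> 0 <= s ->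
  (1 + s) ^+ 3 * expR (- (2 * (s / a))) <= (3 * a) ^+ 3 * expR (- (s / a)).
Proof.
move=> a1 s0; have a0 : 0 < a by lra.
have -> : 2 * (s / a) = s / a + s / a by ring.
rewrite opprD expRD mulrA ler_wpM2r ?expR_ge0//.
rewrite expRN ler_pdivrMr ?expR_gt0//.
have -> : expR (s / a) = expR (s / (3 * a)) ^+ 3.
  by rewrite -expRM_natl; congr expR; field; rewrite gt_eqF.
rewrite -exprMn lerXn2r ?nnegrE ?addr_ge0 ?mulr_ge0 ?expR_ge0//; first by lra.
have := expR_ge1Dx (s / (3 * a)).
move/(ler_wpM2l (le_trans ler01 a1)); apply: le_trans.
by rewrite mulrDr mulr1 mulrCA divff ?mulr1 ?lerD2r// gt_eqF// mulr_gt0.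
Qed.

(** * Lipschitz bounds for matrix functions *)

Lemma norm_sum_le n (F : 'I_n -> R) K : (forall i, `|F i| <= K) ->
  `|\sum_i F i| <= n%:R * K.
Proof.
move=> FK; rewrite (le_trans (ler_norm_sum _ _ _))//.
apply: (le_trans (ler_sum _ (fun i _ => FK i))).
by rewrite sumr_const card_ord mulr_natl.
Qed.

Lemma prod_norm_le n (a : 'I_n -> R) M : (forall i, `|a i| <= M) ->
  `|\prod_i a i| <= M ^+ n.
Proof.
move=> aM; rewrite normr_prod -[n in leRHS]card_ord -prodr_const.
by apply: ler_prod => i _; rewrite normr_ge0 aM.
Qed.

Lemma prod_lip n (a b : 'I_n -> R) M d : 1 <= M -> 0 <= d ->
  (forall i, `|a i| <= M) -> (forall i, `|b i| <= M) ->
  (forall i, `|a i - b i| <= d) ->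
  `|\prod_i a i - \prod_i b i| <= n%:R * M ^+ n * d.
Proof.
move=> M1 d0; elim: n a b => [|n IHn] a b aM bM ab.
  by rewrite !big_ord0 subrr normr0 !mul0r.
have M0 : 0 <= M by lra.
rewrite !big_ord_recl /=.
set pa := \prod_(i < n) _; set pb := \prod_(i < n) _.
have -> : a ord0 * pa - b ord0 * pb = a ord0 * (pa - pb) + (a ord0 - b ord0) * pb.
  by ring.
have h1 : `|a ord0 * (pa - pb)| <= M * (n%:R * M ^+ n * d).
  by rewrite normrM ler_pM//; exact: IHn.
have h2 : `|(a ord0 - b ord0) * pb| <= d * M ^+ n.+1.
  rewrite normrM ler_pM//; apply: (@le_trans _ _ (M ^+ n)).
    exact: prod_norm_le.
  by rewrite exprS ler_peMl// exprn_ge0.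
apply: (le_trans (ler_normD _ _)); apply: (le_trans (lerD h1 h2)).
by rewrite exprS -natr1 le_eqVlt; apply/orP; left; apply/eqP; ring.
Qed.

Lemma det_norm_le n (A : 'M[R]_n) M : (forall i j, `|A i j| <= M) ->
  `|\det A| <= n`!%:R * M ^+ n.
Proof.
move=> AM; rewrite (le_trans (ler_norm_sum _ _ _))//.
rewrite -card_Sn mulr_natl -sumr_const ler_sum// => s _.
by rewrite normrMsign; exact: prod_norm_le.
Qed.

Lemma det_lip n (A B : 'M[R]_n) M d : 1 <= M -> 0 <= d ->
  (forall i j, `|A i j| <= M) -> (forall i j, `|B i j| <= M) ->
  (forall i j, `|A i j - B i j| <= d) ->
  `|\det A - \det B| <= n`!%:R * (n%:R * M ^+ n * d).
Proof.
move=> M1 d0 AM BM AB; rewrite -sumrB (le_trans (ler_norm_sum _ _ _))//.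
rewrite -card_Sn mulr_natl -sumr_const ler_sum// => s _.
by rewrite -mulrBr normrMsign; exact: prod_lip.
Qed.

(** The factors are replaced one at a time, whence bounds on [y], [z], [x'] and [y']
    only. *)
Lemma mul3_lip (x y z x' y' z' X Y Z dx dy dz : R) :
  `|y| <= Y -> `|z| <= Z -> `|x'| <= X -> `|y'| <= Y ->
  `|x - x'| <= dx -> `|y - y'| <= dy -> `|z - z'| <= dz ->
  `|x * y * z - x' * y' * z'| <= dx * Y * Z + X * dy * Z + X * Y * dz.
Proof.
move=> yY zZ xX y'Y xx yy zz.
have -> : x * y * z - x' * y' * z' =
  (x - x') * y * z + x' * (y - y') * z + x' * y' * (z - z') by ring.
apply: (le_trans (ler_normD _ _)); apply: lerD.
  apply: (le_trans (ler_normD _ _)); apply: lerD.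
all: by rewrite !normrM !ler_pM// mulr_ge0.
Qed.

Lemma quadratic_form_lip n (u1 u2 : 'cV[R]_n) (A1 A2 : 'M[R]_n) T a du dA :
  (forall i, `|u1 i ord0| <= T) -> (forall i, `|u2 i ord0| <= T) ->
  (forall i, `|u1 i ord0 - u2 i ord0| <= du) ->
  (forall i j, `|A1 i j| <= a) -> (forall i j, `|A2 i j| <= a) ->
  (forall i j, `|A1 i j - A2 i j| <= dA) ->
  `|(u1^T *m A1 *m u1) ord0 ord0 - (u2^T *m A2 *m u2) ord0 ord0| <=
    n%:R * (n%:R * (du * a * T + T * dA * T + T * a * du)).
Proof.
move=> u1T u2T u12 A1a A2a A12; rewrite !mxE -sumrB; apply: norm_sum_le => j.
rewrite !mxE !mulr_suml -sumrB; apply: norm_sum_le => i.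
by rewrite !mxE; exact: mul3_lip.
Qed.

(** This rests on the resolvent identity
    [C1^-1 - C2^-1 = C1^-1 (C2 - C1) C2^-1]. *)
Lemma invmx_lip n (C1 C2 : 'M[R]_n) a d :
  C1 \in unitmx -> C2 \in unitmx ->
  (forall i j, `|invmx C1 i j| <= a) -> (forall i j, `|invmx C2 i j| <= a) ->
  (forall i j, `|C1 i j - C2 i j| <= d) ->
  forall i j, `|invmx C1 i j - invmx C2 i j| <= n%:R * (n%:R * (a * d * a)).
Proof.
move=> uC1 uC2 C1a C2a C12 i j.
have E : invmx C1 - invmx C2 = invmx C1 *m (C2 - C1) *m invmx C2.
  by rewrite mulmxBr mulVmx// mulmxBl mul1mx mulmxK.
have -> : invmx C1 i j - invmx C2 i j = (invmx C1 - invmx C2) i j.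
  by rewrite !mxE.
rewrite E mxE; apply: norm_sum_le => k.
rewrite mxE mulr_suml; apply: norm_sum_le => l.
by rewrite !mxE !normrM !ler_pM ?mulr_ge0// distrC.
Qed.

End scalar_bounds.

(** * Pointwise bounds for gaussian densities *)

Section gaussian_pdf_bounds.
Context {R : realType} {n : nat}.
Variable r : R.
Hypothesis r1 : 1 <= r.
Implicit Types (m : 'cV[R]_n) (C : 'M[R]_n) (x : Rn R n).

Definition sandwiched m C : Prop :=
  [/\ enorm m <= r, loewner_le (r ^- 2)%:M C & loewner_le C (r ^+ 2)%:M].

(** This is [exp(- |x|^2 / (8 r^2))], in the shape of a product of gaussian
    functions of standard deviation [2 r]; see [envelopeE]. *)
Definition envelope x : R :=
  expR (- (\sum_(i < n) coord i x ^+ 2 / ((2 * r) ^+ 2 *+ 2))).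

Let detlb : R := (n`!%:R * (r ^+ 2) ^+ n)^-1.

Let r0 : 0 < r. Proof. exact: lt_le_trans r1. Qed.
Let r20 : 0 < r ^+ 2. Proof. exact: exprn_gt0. Qed.

Let r21 : 1 <= r ^+ 2. Proof. exact: exprn_ege1. Qed.

Lemma sqr_enorm (v : 'cV[R]_n) : enorm v ^+ 2 = dotp v v.
Proof.
rewrite /enorm sqr_sqrtr ?sumr_ge0// => [|i _]; last exact: sqr_ge0.
by rewrite dotpE; apply: eq_bigr => i _; rewrite expr2.
Qed.

Lemma enorm_ge0 (v : 'cV[R]_n) : 0 <= enorm v.
Proof. exact: sqrtr_ge0. Qed.

Lemma weightE x : weight x = 1 + dotp (vec x) (vec x).
Proof. by rewrite /weight sqr_enorm. Qed.

Lemma envelopeE x : envelope x = expR (- (dotp (vec x) (vec x) / (8 * r ^+ 2))).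
Proof.
have -> : dotp (vec x) (vec x) = \sum_(i < n) coord i x ^+ 2.
  by rewrite dotpE; apply: eq_bigr => i _; rewrite mxE expr2.
have -> : 8 * r ^+ 2 = (2 * r) ^+ 2 *+ 2 by ring.
by rewrite mulr_suml.
Qed.

Let dotp_mean m C : sandwiched m C -> dotp m m <= r ^+ 2.
Proof.
by case=> mr _ _; rewrite -sqr_enorm lerXn2r ?nnegrE ?enorm_ge0// ltW.
Qed.

Let detlb_gt0 : 0 < detlb.
Proof. by rewrite invr_gt0 mulr_gt0 ?ltr0n ?fact_gt0// exprn_gt0. Qed.

(** The entries of [C^-1] bound its determinant, which is the inverse of that of
    [C]. The factor [2 * pi] only helps, being at least [1]. *)
Lemma det_sandwiched_ge m C : sandwiched m C -> detlb <= `|\det ((2 * pi) *: C)|.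
Proof.
move=> [_ lC uC]; rewrite detZ normrM.
have uC' := loewner_unitmx r1 lC.
have dC : detlb <= `|\det C|.
  rewrite -[leRHS]invrK -normrV; last by rewrite -unitmxE.
  rewrite -det_inv lef_pV2 ?posrE ?normr_gt0; last 2 first.
  - by rewrite mulr_gt0 ?ltr0n ?fact_gt0// exprn_gt0.
  - by rewrite det_inv invr_eq0 -unitfE -unitmxE.
  by apply: det_norm_le => i j; exact: loewner_inv_entry.
apply: (le_trans dC); rewrite ler_peMl//.
have pi2 := pi_ge2 R.
by rewrite ger0_norm ?exprn_ge0 ?exprn_ege1//; lra.
Qed.

(** The lower bound on [C^-1] reduces this to [|x|^2 / 2 - |m|^2 <= |x - m|^2],
    that is to [0 <= |x - 2 m|^2]. *)
Lemma gaussian_exponent_ge m C x : sandwiched m C ->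
  2 * (dotp (vec x) (vec x) / (8 * r ^+ 2)) - 2^-1 <=
  ((vec x - m)^T *m invmx C *m (vec x - m)) ord0 ord0 / 2.
Proof.
move=> smC; have mr := dotp_mean smC; case: smC => _ lC uC.
have -> : vec x - m = vec x + (-1) *: m by rewrite scaleN1r.
have := loewner_inv_form r1 lC uC (vec x + (-1) *: m).
rewrite -mulmxA -/(dotp _ _); set q := dotp _ (invmx C *m _).
have := dotp_ge0 (vec x + (- 2) *: m).
rewrite !(dotpDl, dotpDr, dotpZl, dotpZr) (dotpC m (vec x)).
set s := dotp (vec x) (vec x); set xm := dotp (vec x) m => h.
set t := r ^- 2; have t0 : 0 < t by rewrite invr_gt0.
have tr : t * r ^+ 2 = 1 by rewrite mulVf// gt_eqF.
have -> : 2 * (s / (8 * r ^+ 2)) = t * s / 4.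
  by rewrite /t; field; rewrite gt_eqF.
move=> hq.
have : t * (s / 2 - r ^+ 2) <= q.
  apply: le_trans hq; apply: ler_wpM2l; [exact: ltW|lra].
rewrite mulrBr tr; lra.
Qed.

Lemma entry_centered_le m C x i : sandwiched m C ->
  `|(vec x - m) i ord0| <= (1 + r) * (1 + dotp (vec x) (vec x)).
Proof.
move=> smC; have mr := dotp_mean smC.
have s0 := dotp_ge0 (vec x).
rewrite !mxE; apply: (le_trans (ler_normB _ _)).
have xi := sqr_entry_le_dotp (vec x) i.
have mi := le_trans (sqr_entry_le_dotp m i) mr.
have {}mi : `|m i ord0| <= r.
  by rewrite -ler_sqr ?nnegrE// ?(ltW r0)// real_normK ?num_real.
have {}xi : `|coord i x| <= 1 + dotp (vec x) (vec x).
  rewrite mxE -(real_normK (num_real _)) in xi.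
  by move: xi (normr_ge0 (coord i x)); nra.
have := mulr_ge0 (ltW r0) s0; lra.
Qed.

Lemma expR_exponent_le m C x : sandwiched m C ->
  expR (- (((vec x - m)^T *m invmx C *m (vec x - m)) ord0 ord0 / 2)) <=
  expR 2^-1 * expR (- (2 * (dotp (vec x) (vec x) / (8 * r ^+ 2)))).
Proof.
move=> smC; rewrite -expRD ler_expR.
by have := gaussian_exponent_ge x smC; lra.
Qed.

Let poly3_envelope x : (1 + dotp (vec x) (vec x)) ^+ 3 *
    expR (- (2 * (dotp (vec x) (vec x) / (8 * r ^+ 2)))) <=
  (3 * (8 * r ^+ 2)) ^+ 3 * envelope x.
Proof.
rewrite envelopeE poly3_expR_le ?dotp_ge0//.
by move: (r ^+ 2) r21 => z z1; lra.
Qed.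

Lemma gaussian_pdf_le_envelope : exists2 K : R, 0 <= K &
  forall m C x, sandwiched m C -> weight x * gaussian_pdf m C x <= K * envelope x.
Proof.
set N := (Num.sqrt detlb)^-1; have N0 : 0 <= N by rewrite invr_ge0 sqrtr_ge0.
exists (N * expR 2^-1 * (3 * (8 * r ^+ 2)) ^+ 3).
  have r20' := ltW r20.
  by do ?[by [] | apply: expR_ge0 | apply: exprn_ge0 | apply: mulr_ge0].
move=> m C x smC; rewrite weightE /gaussian_pdf.
rewrite -[leRHS]mulrA; apply: le_trans (ler_wpM2l _ (poly3_envelope x)); last first.
  by do ?[by [] | apply: expR_ge0 | apply: mulr_ge0].
set s := dotp _ _; have s0 : 0 <= s by exact: dotp_ge0.
rewrite [leRHS]mulrCA; apply: ler_pM.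
- by rewrite addr_ge0.
- by rewrite mulr_ge0 ?invr_ge0 ?sqrtr_ge0 ?expR_ge0.
- by rewrite -[leLHS]expr1 ler_weXn2l// lerDl.
rewrite -mulrA; apply: ler_pM.
- by rewrite invr_ge0 sqrtr_ge0.
- exact: expR_ge0.
- exact: invsqrt_le (det_sandwiched_ge smC).
- exact: expR_exponent_le.
Qed.

(** The density is the product of a normalizing factor and an exponential; their
    variations are bounded separately. The variation of the exponent is quadratic
    in [1 + |x|^2], and the weight brings one more factor. *)
Lemma gaussian_pdf_lip : exists2 K : R, 0 <= K &
  forall m1 m2 C1 C2 (d : R) x, sandwiched m1 C1 -> sandwiched m2 C2 -> 0 <= d ->
    (forall i, `|m1 i ord0 - m2 i ord0| <= d) ->
    (forall i j, `|C1 i j - C2 i j| <= d) ->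
    weight x * `|gaussian_pdf m1 C1 x - gaussian_pdf m2 C2 x| <=
    K * d * envelope x.
Proof.
set N := (Num.sqrt detlb)^-1; have N0 : 0 <= N by rewrite invr_ge0 sqrtr_ge0.
have pi2 := pi_ge2 R.
set M := 2 * pi * r ^+ 2.
have M1 : 1 <= M by rewrite mulr_ege1//; lra.
set KN := (detlb * Num.sqrt detlb)^-1 * (n`!%:R * (n%:R * M ^+ n * (2 * pi))).
have KN0 : 0 <= KN.
  have M0 := le_trans ler01 M1; have detlb0 := ltW detlb_gt0.
  have pi0 := pi_ge0 R.
  by do ?[by [] | exact: ler0n | exact: sqrtr_ge0 | rewrite invr_ge0
    | apply: exprn_ge0 | apply: mulr_ge0].
set Kq : R := n%:R * (n%:R * (2 * r ^+ 2 * (1 + r) +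
  (1 + r) ^+ 2 * (n%:R * (n%:R * (r ^+ 2 * r ^+ 2))))).
have Kq0 : 0 <= Kq.
  have r0' := ltW r0; have r20' := ltW r20.
  by do ?[by [] | exact: ler0n | apply: exprn_ge0 | apply: mulr_ge0 | apply: addr_ge0].
exists ((N * (Kq / 2) + KN) * expR 2^-1 * (3 * (8 * r ^+ 2)) ^+ 3).
  have r20' := ltW r20.
  by do ?[by [] | apply: expR_ge0 | apply: exprn_ge0 | apply: mulr_ge0
    | apply: addr_ge0].
move=> m1 m2 C1 C2 d x s1 s2 d0 m12 C12; rewrite weightE /gaussian_pdf.
set q1 := _ ord0 ord0 / 2; set q2 := _ ord0 ord0 / 2.
set N1 := (Num.sqrt _)^-1; set N2 := (Num.sqrt _)^-1.
rewrite [X in _ <= X * _]mulrAC -[leRHS]mulrA.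
apply: le_trans (ler_wpM2l _ (poly3_envelope x)); last first.
  by do ?[by [] | apply: expR_ge0 | apply: mulr_ge0 | apply: addr_ge0].
set E := expR (- (2 * _)).
have e2 : expR (- q2) <= expR 2^-1 * E by exact: expR_exponent_le.
have e12 : `|expR (- q1) - expR (- q2)| <= `|q1 - q2| * (expR 2^-1 * E).
  have -> : expR 2^-1 * E =
      expR (- (2 * (dotp (vec x) (vec x) / (8 * r ^+ 2)) - 2^-1)).
    by rewrite -expRD opprB.
  by apply: expRN_lip; exact: gaussian_exponent_ge.
have lC1 : loewner_le (r ^- 2)%:M C1 by case: s1.
have lC2 : loewner_le (r ^- 2)%:M C2 by case: s2.
have s0 := dotp_ge0 (vec x).
have q12 : `|q1 - q2| <= Kq / 2 * (1 + dotp (vec x) (vec x)) ^+ 2 * d.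
  rewrite /q1 /q2 -mulrBl normrM [`|2^-1|]ger0_norm//.
  rewrite [leRHS](_ : _ = Kq * (1 + dotp (vec x) (vec x)) ^+ 2 * d / 2); last by ring.
  rewrite ler_wpM2r//.
  have invC := invmx_lip (loewner_unitmx r1 lC1) (loewner_unitmx r1 lC2)
    (loewner_inv_entry r1 lC1) (loewner_inv_entry r1 lC2) C12.
  apply: le_trans (quadratic_form_lip (fun i => entry_centered_le x i s1)
    (fun i => entry_centered_le x i s2) _ (loewner_inv_entry r1 lC1)
    (loewner_inv_entry r1 lC2) invC) _.
    move=> i; rewrite !mxE [X in `|X|](_ : _ = m2 i ord0 - m1 i ord0); last by ring.
    by rewrite distrC; exact: m12.
  rewrite [leRHS](_ : _ = n%:R * (n%:R * ((2 * r ^+ 2 * (1 + r) +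
    (1 + r) ^+ 2 * (n%:R * (n%:R * (r ^+ 2 * r ^+ 2)))) *
    (1 + dotp (vec x) (vec x)) ^+ 2 * d))); last by rewrite /Kq; ring.
  rewrite ler_wpM2l// ler_wpM2l// -subr_ge0.
  rewrite [leRHS](_ : _ = 2 * r ^+ 2 * (1 + r) * d *
    (dotp (vec x) (vec x) * (1 + dotp (vec x) (vec x)))); last by ring.
  have r0' := ltW r0.
  by do ?[by [] | apply: exprn_ge0 | apply: mulr_ge0 | apply: addr_ge0].
have N1N : `|N1| <= N.
  rewrite ger0_norm ?invr_ge0 ?sqrtr_ge0//.
  exact: invsqrt_le (det_sandwiched_ge s1).
have N12 : `|N1 - N2| <= KN * d.
  apply: (le_trans (invsqrt_lip detlb_gt0 (det_sandwiched_ge s1)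
    (det_sandwiched_ge s2))).
  rewrite /KN -mulrA; apply: ler_wpM2l.
    by rewrite invr_ge0 mulr_ge0 ?sqrtr_ge0// ltW.
  have C_M m C i j : sandwiched m C -> `|((2 * pi) *: C) i j| <= M.
    move=> [_ lC uC]; rewrite mxE normrM ger0_norm; last by lra.
    by rewrite ler_wpM2l ?(loewner_entry r1 lC uC)//; lra.
  rewrite [leRHS](_ : _ = n`!%:R * (n%:R * M ^+ n * (2 * pi * d))); last by ring.
  apply: det_lip => // [|i j|i j|i j].
  - by rewrite mulr_ge0//; lra.
  - exact: C_M s1.
  - exact: C_M s2.
  - rewrite !mxE -mulrBr normrM ger0_norm; last by lra.
    by rewrite ler_wpM2l//; lra.
have -> : N1 * expR (- q1) - N2 * expR (- q2) =
    N1 * (expR (- q1) - expR (- q2)) + (N1 - N2) * expR (- q2) by ring.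
have hE0 : 0 <= expR 2^-1 * E by rewrite mulr_ge0 ?expR_ge0.
have b1 : `|N1 * (expR (- q1) - expR (- q2))| <= N *
    (Kq / 2 * (1 + dotp (vec x) (vec x)) ^+ 2 * d * (expR 2^-1 * E)).
  by rewrite normrM ler_pM// (le_trans e12)// ler_wpM2r.
have b2 : `|(N1 - N2) * expR (- q2)| <= KN * d * (expR 2^-1 * E).
  by rewrite normrM ler_pM// ger0_norm ?expR_ge0.
have S1 : 1 <= 1 + dotp (vec x) (vec x) by rewrite lerDl.
move: S1 b1 b2; set S := 1 + dotp _ _ => S1 b1 b2.
have S0 := le_trans ler01 S1.
apply: le_trans (ler_wpM2l S0 (le_trans (ler_normD _ _) (lerD b1 b2))) _.
rewrite -subr_ge0 [leRHS](_ : _ = KN * d * (expR 2^-1 * E) * (S ^+ 3 - S)).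
  apply: mulr_ge0; first exact: mulr_ge0 (mulr_ge0 KN0 d0) hE0.
  by rewrite subr_ge0 -[leLHS]expr1 ler_weXn2l.
by ring.
Qed.

End gaussian_pdf_bounds.

(** * Moments and the weighted distance *)

Section moments_lip.
Context {R : realType} {n : nat}.
Implicit Types (mu : probability (Rn R n) R) (f : Rn R n -> R).

Lemma measurable_weight : measurable_fun setT (@weight R n).
Proof.
rewrite (_ : weight = fun x => 1 + \sum_(i < n) coord i x * coord i x).
  apply: measurable_funD => //; apply: measurable_sum => i.
  by apply: measurable_funM; exact: measurable_coord.
apply/funext => x; rewrite weightE dotpE; congr (1 + _).
by apply: eq_bigr => i _; rewrite mxE.
Qed.

Lemma weight_ge0 (x : Rn R n) : 0 <= weight x.
Proof. by rewrite weightE addr_ge0 ?dotp_ge0. Qed.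

Lemma coord_le_weight i (x : Rn R n) : `|coord i x| <= weight x.
Proof.
rewrite weightE; have := sqr_entry_le_dotp (vec x) i; rewrite mxE.
rewrite -(real_normK (num_real (coord i x))).
have := normr_ge0 (coord i x); nra.
Qed.

Lemma coordM_le_weight i j (x : Rn R n) : `|coord i x * coord j x| <= weight x.
Proof.
rewrite weightE normrM.
have := sqr_entry_le_dotp (vec x) i; have := sqr_entry_le_dotp (vec x) j.
rewrite !mxE -(real_normK (num_real (coord i x))) -(real_normK (num_real (coord j x))).
have := sqr_ge0 (`|coord i x| - `|coord j x|); nra.
Qed.

Lemma integrable_le_weight mu f :
  (\int[mu]_x (enorm (vec x) ^+ 2)%:E < +oo)%E ->
  measurable_fun setT f -> (forall x, `|f x| <= weight x) ->
  mu.-integrable setT (EFin \o f).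
Proof.
move=> fin2 mf fw.
have msq : measurable_fun setT (fun x : Rn R n => enorm (vec x) ^+ 2).
  rewrite (_ : (fun _ => _) = weight \- cst 1).
    by apply: measurable_funB => //; exact: measurable_weight.
  by apply/funext => x /=; rewrite /weight addrAC subrr add0r.
have iw : mu.-integrable setT (EFin \o (fun x : Rn R n => 1 + enorm (vec x) ^+ 2)).
  apply: (integrableD measurableT (f := cst 1%E)
    (g := EFin \o (fun x : Rn R n => enorm (vec x) ^+ 2))).
    exact: finite_measure_integrable_cst.
  apply/integrableP; split; first exact/measurable_EFinP.
  by under eq_integral do rewrite /= ger0_norm ?sqr_ge0//.
apply: le_integrable iw => //; first exact/measurable_EFinP.
by move=> x _; rewrite /= lee_fin [leRHS]ger0_norm ?weight_ge0// fw.
Qed.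

Lemma expectation_dg mu1 mu2 f d :
  (\int[mu1]_x (enorm (vec x) ^+ 2)%:E < +oo)%E ->
  (\int[mu2]_x (enorm (vec x) ^+ 2)%:E < +oo)%E ->
  measurable_fun setT f -> (forall x, `|f x| <= weight x) ->
  dg mu1 mu2 = d%:E ->
  `|fine 'E_mu1[f] - fine 'E_mu2[f]| <= d.
Proof.
move=> fin1 fin2 mf fw dgE.
have i1 := integrable_le_weight fin1 mf fw.
have i2 := integrable_le_weight fin2 mf fw.
rewrite -lee_fin -dgE -abse_EFin EFinB.
rewrite !fineK ?expectation_fin_num ?Lfun1_integrable//.
rewrite unlock; apply: ereal_sup_ubound; exists f => //; split => //.
Qed.

Lemma mean_dg r mu1 mu2 d : in_PR r mu1 -> in_PR r mu2 -> dg mu1 mu2 = d%:E ->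
  forall i, `|mean mu1 i ord0 - mean mu2 i ord0| <= d.
Proof.
move=> [fin1 _ _ _] [fin2 _ _ _] dgE i; rewrite !mxE.
apply: expectation_dg dgE => //; first exact: measurable_coord.
exact: coord_le_weight.
Qed.

Lemma cov_entry mu i j : (\int[mu]_x (enorm (vec x) ^+ 2)%:E < +oo)%E ->
  cov mu i j = fine 'E_mu[coord i * coord j] - mean mu i ord0 * mean mu j ord0.
Proof.
move=> fin2.
have L1 k : coord k \in Lfun mu 1.
  apply/Lfun1_integrable/integrable_le_weight => //.
    exact: measurable_coord.
  exact: coord_le_weight.
have L2 : (coord i * coord j : Rn R n -> R) \in Lfun mu 1.
  apply/Lfun1_integrable/integrable_le_weight => //.
    by apply: measurable_funM; exact: measurable_coord.
  exact: coordM_le_weight.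
rewrite !mxE covarianceE// fineB ?fin_numM ?expectation_fin_num//.
by rewrite fineM ?expectation_fin_num.
Qed.

Lemma cov_dg r mu1 mu2 d : in_PR r mu1 -> in_PR r mu2 -> dg mu1 mu2 = d%:E ->
  forall i j, `|cov mu1 i j - cov mu2 i j| <= (1 + 2 * r) * d.
Proof.
move=> P1 P2 dgE i j.
have m12 := mean_dg P1 P2 dgE.
have [fin1 m1r _ _] := P1; have [fin2 m2r _ _] := P2.
have mr mu k : enorm (mean mu) <= r -> `|mean mu k ord0| <= r.
  move=> h; have r0 := le_trans (enorm_ge0 _) h.
  rewrite -ler_sqr ?nnegrE// real_normK ?num_real//.
  apply: le_trans (sqr_entry_le_dotp _ _) _.
  by rewrite -sqr_enorm lerXn2r ?nnegrE ?enorm_ge0.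
have r0 := le_trans (enorm_ge0 _) m1r.
rewrite !cov_entry//.
have h : `|fine 'E_mu1[coord i * coord j] - fine 'E_mu2[coord i * coord j]| <= d.
  apply: expectation_dg dgE => //.
    by apply: measurable_funM; exact: measurable_coord.
  exact: coordM_le_weight.
have -> (a b x1 x2 y1 y2 : R) : a - x1 * y1 - (b - x2 * y2) =
    (a - b) - (x1 * (y1 - y2) + (x1 - x2) * y2) by ring.
apply: (le_trans (ler_normB _ _)).
rewrite [leRHS](_ : _ = d + (r * d + d * r)); last by ring.
apply: lerD => //; apply: (le_trans (ler_normD _ _)).
by rewrite !normrM lerD// ler_pM// mr.
Qed.

End moments_lip.

(** * Lipschitz continuity of the gaussian projection *)

Theorem lemma28 (R : realType) (n : nat) (r : R) (hn : (1 <= n)%N) (hr : 1 <= r) :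
  exists L : R, forall mu1 mu2 : probability (Rn R n) R,
    in_PR r mu1 -> in_PR r mu2 ->
    (dg (gaussian_proj mu1) (gaussian_proj mu2) <= L%:E * dg mu1 mu2)%E.
Proof.
have [K1 K10 K1P] := @gaussian_pdf_le_envelope R n r hr.
have [K2 K20 K2P] := @gaussian_pdf_lip R n r hr.
have r0 : 0 < r by lra.
have r20 : 2 * r != 0 by rewrite gt_eqF// mulr_gt0.
pose J : R := (normal_peak (2 * r))^-1 ^+ n.
have J0 : 0 <= J by rewrite exprn_ge0// invr_ge0 normal_peak_ge0.
pose L := K2 * (1 + 2 * r) * J + 1.
have L0 : 0 < L.
  by apply: ltr_wpDl => //; rewrite mulr_ge0// mulr_ge0//; lra.
exists L => mu1 mu2 P1 P2.
have dg0 : (0 <= dg mu1 mu2)%E.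
  apply: ereal_sup_ubound; exists (cst 0).
    by split => // x; rewrite normr0 weight_ge0.
  by rewrite !integral0 sube0 abse0.
(* The summand [1] in [L] makes it positive, which settles the case of an infinite
   distance. *)
case dgE : (dg mu1 mu2) dg0 => [d| |]//; last first.
  by move=> _; rewrite gt0_muley ?lte_fin// leey.
rewrite lee_fin => d0.
have s1 : sandwiched r (mean mu1) (cov mu1) by case: P1.
have s2 : sandwiched r (mean mu2) (cov mu2) by case: P2.
pose delta := (1 + 2 * r) * d.
have delta0 : 0 <= delta by rewrite mulr_ge0//; lra.
have m12 i : `|mean mu1 i ord0 - mean mu2 i ord0| <= delta.
  apply: (le_trans (mean_dg P1 P2 dgE i)).
  by rewrite /delta ler_peMl//; lra.
have C12 := cov_dg P1 P2 dgE.
apply: ge_ereal_sup => _ [f [mf fw] <-].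
apply: (@le_trans _ _ (K2 * delta * J)%:E); last first.
  rewrite -EFinM lee_fin /L /delta [leRHS]mulrDl.
  rewrite [leLHS](_ : _ = K2 * (1 + 2 * r) * J * d); last by ring.
  by rewrite lerDl mul1r.
have fp m C x : sandwiched r m C -> `|f x| * gaussian_pdf m C x <= K1 * envelope r x.
  by move=> smC; rewrite (le_trans _ (K1P m C x smC))// ler_wpM2r ?gaussian_pdf_ge0.
apply: (@integral_density_dist _ _ _ (lebesgue_Rn R n) _ _
  (gaussian_pdf (mean mu1) (cov mu1)) (gaussian_pdf (mean mu2) (cov mu2))
  f (envelope r) J K1).
- exact: measurable_gaussian_pdf.
- exact: measurable_gaussian_pdf.
- exact: gaussian_pdf_ge0.
- exact: gaussian_pdf_ge0.
- by [].
- by [].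
- by [].
- apply: measurableT_comp => //; apply: measurableT_comp => //.
  apply: measurable_sum => i; apply: measurable_funM => //.
  by apply: measurable_funX; exact: measurable_coord.
- by move=> x; exact: expR_ge0.
- exact: integral_lebesgue_Rn_expR.
- by move=> x; exact: fp.
- by move=> x; exact: fp.
- exact: mulr_ge0.
- move=> x; apply: le_trans (K2P _ _ _ _ delta x s1 s2 delta0 m12 C12).
  by rewrite ler_wpM2r.
Qed.
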